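(* Let $G=(V,E)$ be a $d$-regular graph, and let $\gamma$ be the spectral gap of the simple random walk on $G$. Let $1\le \beta \leq 1+\gamma/32$, and let $w : E \to \mathbb{R}_+$ be a $\beta$-Lipschitz edge-weighting. Then the chain $P_w$ induced by $w$ satisfies \[ \gamma_{P_w} \ge 10^{-8} \cdot d^{-16/\gamma}. \]
   Context: All graphs are finite, simple, undirected and connected. $\mathbb{R}_+$ denotes the positive reals. The simple random walk on $G$ is the (non-lazy) Markov chain which in each step moves to a uniformly random neighbour of the current vertex. For an edge-weighting $w:E\to\mathbb{R}_+$, the chain $P_w$ induced by $w$ has $P_w(x,y)=w(x,y)/w(x)$ if $\{x,y\}\in E$ and $P_w(x,y)=0$ otherwise, where $w(x)=\sum_{z:\,z\sim x}w(x,z)$. It is reversible. For $\beta\ge 1$, $w$ is $\beta$-Lipschitz if $1/\beta\le w(x,y)/w(x,z)\le\beta$ for all $x,y,z\in V$ with $y\sim x\sim z$. The spectral gap of a reversible irreducible chain $P$ with eigenvalues $1=\lambda_1>\lambda_2\ge\dots\ge\lambda_n\ge-1$ is $\gamma_P=1-\lambda_2$. *)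

(* Defs.v *)
From HB Require Import structures.
From mathcomp Require Import all_boot all_order all_algebra.
From mathcomp Require Import all_classical all_reals all_analysis.

Set Implicit Arguments.
Unset Strict Implicit.
Unset Printing Implicit Defensive.

Import Order.TTheory GRing.Theory Num.Theory.
Local Open Scope classical_set_scope.
Local Open Scope ring_scope.

Definition simple_graph (V : finType) (e : rel V) : Prop :=
  symmetric e /\ irreflexive e.

Definition connected_graph (V : finType) (e : rel V) : Prop :=
  forall x y : V, connect e x y.

Definition degree (V : finType) (e : rel V) (x : V) : nat :=
  #|[pred y | e x y]|.

Definition regular_graph (V : finType) (e : rel V) (d : nat) : Prop :=
  forall x : V, degree e x = d.

(* A weighting of the undirected edges is a function of ordered pairs that is
   symmetric and positive on adjacent pairs; its values on other pairs are
   unconstrained and never used. *)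
Definition edge_weighting (R : realType) (V : finType) (e : rel V)
    (w : V -> V -> R) : Prop :=
  forall x y : V, e x y -> 0 < w x y /\ w x y = w y x.

Definition lipschitz_weighting (R : realType) (V : finType) (e : rel V)
    (beta : R) (w : V -> V -> R) : Prop :=
  forall x y z : V, e y x -> e x z ->
    1 / beta <= w x y / w x z /\ w x y / w x z <= beta.

Definition vertex_weight (R : realType) (V : finType) (e : rel V)
    (w : V -> V -> R) (x : V) : R :=
  \sum_(z | e x z) w x z.

Definition weighted_chain (R : realType) (V : finType) (e : rel V)
    (w : V -> V -> R) (x y : V) : R :=
  if e x y then w x y / vertex_weight e w x else 0.

Definition simple_random_walk (R : realType) (V : finType) (e : rel V)
    (x y : V) : R :=
  if e x y then (degree e x)%:R^-1 else 0.

Definition transition_matrix (R : realType) (V : finType) (P : V -> V -> R) :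
    'M[R]_#|V| :=
  \matrix_(i, j) P (enum_val i) (enum_val j).

Definition is_spectrum (R : realType) (n : nat) (M : 'M[R]_n) (s : seq R) :
    Prop :=
  sorted >=%R s /\ char_poly M = \prod_(l <- s) ('X - l%:P).

Lemma is_spectrum_uniq (R : realType) (n : nat) (M : 'M[R]_n) (s t : seq R) :
  is_spectrum M s -> is_spectrum M t -> s = t.
Proof.
move=> [ss es] [st et]; apply: (sorted_eq ge_trans ge_anti) => //.
by apply: prod_XsubC_eq; rewrite -es -et.
Qed.

(* The real eigenvalues with algebraic multiplicity, in nonincreasing order;
   the default [::] is taken when the characteristic polynomial does not split
   over R, which does not happen for a reversible chain. *)
Definition spectrum (R : realType) (n : nat) (M : 'M[R]_n) : seq R :=
  xget [::] [set s | is_spectrum M s].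

Lemma spectrumE (R : realType) (n : nat) (M : 'M[R]_n) (s : seq R) :
  is_spectrum M s -> spectrum M = s.
Proof.
by move=> hs; apply: (is_spectrum_uniq _ hs); exact: (xgetI [::] hs).
Qed.

(* The second largest eigenvalue has index 1, counting from 0; on fewer
   than two vertices it does not exist and the gap is 1 by default. *)
Definition spectral_gap (R : realType) (V : finType) (P : V -> V -> R) : R :=
  1 - nth 0 (spectrum (transition_matrix P)) 1.

(* Main.v *)
Require Import Defs.
From HB Require Import structures.
From mathcomp Require Import all_boot all_order all_algebra.
From mathcomp Require Import all_classical all_reals all_analysis.
From mathcomp Require Import complex ring lra.

(** The chain [P_w] is reversible for the vertex weight [m x], the total weight
    at [x]. The Lipschitz condition makes [m] vary slowly: across an edge,
    [sqrt m] changes by a factor between [1 / beta] and [beta]. Given [f], put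
    [g = sqrt m * f] (a ground state transform). The norm of [g] in the counting
    measure is the norm of [f] in [m], and [g x - g y] differs from
    [sqrt (m x) * (f x - f y)] by at most [(beta - 1) * |g y|]. So the Poincare
    inequality of the simple random walk, applied to [g], becomes one for [P_w]
    with an error term [(beta - 1) ^+ 2] times the norm, which [gamma] absorbs
    because [beta - 1 <= gamma / 32] ([ground_state_comparison]).

    That Poincare inequality requires [g] to have mean zero, that is, [f]
    orthogonal to [sqrt m] in the counting measure, and not to the stationary
    measure. This does no harm: by the min-max principle a spectral gap is
    bounded below as soon as the energy dominates the norm on some hyperplane
    ([spectral_gap_ge]). The outcome, [lipschitz_spectral_gap], is
    [(gamma - (beta - 1) ^+ 2) / (2 * beta)], which is at least [gamma / 8].

    This is stronger than the claim. For [d >= 2] one has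
    [d ^ (- 16 / gamma) <= gamma / 8] since [2 ^ r >= r / 2]. For [d = 1] the
    graph is one edge and [gamma >= 1]. On at most one vertex both gaps are 1.

    Eigenvalues enter through the roots of the characteristic polynomial, so the
    variational statements rest on an orthonormal eigenbasis of a reversible
    chain, deduced from the spectral theorem for real symmetric matrices
    ([real_spectral_theorem]). *)

Set Implicit Arguments.
Unset Strict Implicit.
Unset Printing Implicit Defensive.

Import Order.TTheory GRing.Theory Num.Theory.
Local Open Scope ring_scope.

(** * Spectral theorem for real symmetric matrices *)

(** Over [R[i]] a real symmetric matrix is Hermitian, so it diagonalises with
    real eigenvalues; being an eigenvalue of [S] does not depend on the field,
    so any of them already has a real eigenvector. *)
Lemma symmetric_eigenvalue (R : rcfType) (n : nat) (S : 'M[R]_n.+1) :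
  S^T = S -> exists a, eigenvalue S a.
Proof.
move=> symS; pose A := map_mx (real_complex R) S.
have Asym : A \is symmetricmx.
  apply/is_hermitianmxP; rewrite expr0 scale1r; apply/matrixP => i j.
  by rewrite !mxE -[in LHS]symS mxE.
have Areal : A \is a mxOver Num.real.
  by apply/mxOverP => i j; rewrite mxE complex_real.
have Aherm := realsym_hermsym Asym Areal.
have /orthomx_spectralP := hermitian_normalmx Aherm.
have /mxOverP /(_ 0 0) := hermitian_spectral_diag_real Aherm.
set P := spectralmx A; set D := spectral_diag A => /complex_realP[r Dr] AE.
have uP : P \in unitmx by exact: spectral_unit.
exists r; rewrite -(eigenvalue_map (real_complex R)).
apply/eigenvalueP; exists (row 0 P).
  rewrite -/A {1}AE -row_mul !mulmxA mulmxV // mul1mx row_mul row_diag_mx.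
  by rewrite -scalemxAl -rowE Dr.
by have := row_free_unit P; rewrite uP => /row_freeP[B] PB; apply/eqP => r0;
  have := congr1 (row 0) PB; rewrite row_mul r0 mul0mx => /rowP/(_ 0);
  rewrite !mxE eqxx => /esym/eqP; rewrite oner_eq0.
Qed.

Lemma char_poly_conj (R : comNzRingType) (n : nat) (P Q A : 'M[R]_n) :
  Q *m P = 1%:M -> char_poly (P *m A *m Q) = char_poly A.
Proof.
move=> QP; have PQ := mulmx1C QP.
rewrite /char_poly /char_poly_mx !map_mxM.
have XE : 'X%:M = map_mx polyC P *m 'X%:M *m map_mx polyC Q.
  by rewrite scalar_mxC -mulmxA -map_mxM PQ map_mx1 mulmx1.
rewrite [in LHS]XE -mulmxBl -mulmxBr !det_mulmx mulrAC -det_mulmx.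
rewrite -map_mxM PQ map_mx1.
by rewrite det1 mul1r.
Qed.

Lemma row_normE (R : pzSemiRingType) (n : nat) (u : 'rV[R]_n) :
  (u *m u^T) 0 0 = \sum_i u 0 i ^+ 2.
Proof. by rewrite mxE; apply: eq_bigr => i _; rewrite mxE expr2. Qed.

Lemma row_norm_eq0 (R : realDomainType) (n : nat) (u : 'rV[R]_n) :
  (u *m u^T) 0 0 = 0 -> u = 0.
Proof.
rewrite row_normE => /eqP.
rewrite psumr_eq0; last by move=> i _; exact: sqr_ge0.
by move/allP=> h; apply/rowP => i; have := h i (mem_index_enum _);
  rewrite sqrf_eq0 mxE => /eqP.
Qed.

(** The Householder reflection that exchanges the first basis vector and the
    unit vector [v]; it serves to deflate a matrix along an eigenvector. *)
Lemma orthogonal_extension (R : realFieldType) (n : nat) (v : 'rV[R]_n.+1) :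
  v *m v^T = 1%:M -> exists H : 'M[R]_n.+1, H *m H^T = 1%:M /\ row 0 H = v.
Proof.
move=> vv; pose e0 : 'rV[R]_n.+1 := delta_mx 0 0.
have ee : e0 *m e0^T = 1%:M.
  by rewrite trmx_delta mul_delta_mx; apply/matrixP => i j; rewrite !ord1 !mxE.
have [ve|ve] := eqVneq v e0.
  by exists 1%:M; rewrite trmx1 mulmx1 ve row1.
have [u uE] : exists u, u = v - e0 by exists (v - e0).
pose c := (u *m u^T) 0 0.
have uu : u *m u^T = c%:M by rewrite [LHS]mx11_scalar.
have c0 : c != 0.
  by apply: contra_neq ve => /row_norm_eq0 /eqP; rewrite uE subr_eq0 => /eqP.
have eu : e0 *m u^T = (- c / 2)%:M.
  have ve_sym : v *m e0^T = e0 *m v^T.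
    by rewrite [LHS]mx11_scalar -tr_scalar_mx -mx11_scalar trmx_mul trmxK.
  have /(congr1 (fun M : 'M[R]_1 => M 0 0)) := uu.
  rewrite [e0 *m _]mx11_scalar uE linearB /= !mulmxBl !mulmxBr vv ee ve_sym.
  set s := e0 *m v^T; rewrite !mxE eqxx /= !mulr1n => h.
  by congr (_%:M); rewrite -h; field.
pose H : 'M[R]_n.+1 := 1%:M - (2 / c) *: (u^T *m u).
have Hsym : H^T = H.
  by rewrite /H linearB /= linearZ /= trmx_mul trmxK trmx1.
exists H; split.
  rewrite Hsym /H mulmxBl mul1mx mulmxBr mulmx1 -scalemxAl -scalemxAr.
  rewrite -mulmxA [u *m (_ *m _)]mulmxA uu mul_scalar_mx -scalemxAr.
  rewrite !scalerA; set M := u^T *m u.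
  have -> : 2 / c * (2 / c * c) = 2 / c + 2 / c by field.
  by rewrite scalerDl opprB addrK subrK.
rewrite rowE /H mulmxBr mulmx1 -scalemxAr mulmxA eu mul_scalar_mx scalerA.
have -> : 2 / c * (- c / 2) = -1 by field.
by rewrite scaleN1r opprK uE -/e0 addrC subrK.
Qed.

(** Induction on the size: conjugating by an orthogonal matrix whose first row
    is a unit eigenvector leaves a block-diagonal matrix, because the first row
    becomes a multiple of the first basis vector and the matrix stays
    symmetric. *)
Theorem real_spectral_theorem (R : rcfType) (n : nat) (S : 'M[R]_n) :
  S^T = S ->
  exists (Q : 'M[R]_n) (D : 'rV[R]_n),
    Q *m Q^T = 1%:M /\ S = Q^T *m diag_mx D *m Q.
Proof.
elim: n S => [|n IHn] S symS.
  by exists 1%:M, 0; split; apply/matrixP => -[].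
have [a /eigenvalueP[v0 v0S v0_neq0]] := symmetric_eigenvalue symS.
pose c := (v0 *m v0^T) 0 0.
have c_gt0 : 0 < c.
  rewrite lt_neqAle eq_sym; apply/andP; split.
    by apply: contra_neq v0_neq0; exact: row_norm_eq0.
  by rewrite /c row_normE sumr_ge0 // => i _; exact: sqr_ge0.
pose v := (Num.sqrt c)^-1 *: v0.
have vS : v *m S = a *: v by rewrite -scalemxAl v0S !scalerA mulrC.
have vv : v *m v^T = 1%:M.
  rewrite /v linearZ /= -scalemxAl -scalemxAr scalerA [v0 *m _]mx11_scalar -/c.
  rewrite scale_scalar_mx -invfM -expr2 sqr_sqrtr ?(ltW c_gt0) //.
  by rewrite mulVf // gt_eqF.
have [H [HH H0]] := orthogonal_extension vv.
have HTH := mulmx1C HH.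
pose T : 'M[R]_(1 + n) := H *m S *m H^T.
have symT : T^T = T by rewrite /T !trmx_mul trmxK symS mulmxA.
have T0 : row 0 T = a *: delta_mx 0 0.
  by rewrite /T !row_mul H0 vS -scalemxAl -H0 -row_mul HH row1.
have Tur : ursubmx T = 0.
  apply/rowP => j; have /rowP/(_ (rshift 1 j)) := T0.
  rewrite !mxE !lshift0 => ->.
  by rewrite -(inj_eq val_inj) /= mulr0.
have Tul : ulsubmx T = a%:M.
  apply/matrixP => i j; have /rowP/(_ (lshift n j)) := T0.
  by rewrite !ord1 !mxE !lshift0 eqxx mulr1 mulr1n => ->.
have TE : T = block_mx a%:M 0 0 (drsubmx T).
  rewrite -{1}[T]submxK Tur Tul; congr block_mx.
  by rewrite -[T]symT -trmx_ursub Tur trmx0.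
have [|Q' [D' [QQ DE]]] := IHn (drsubmx T); first by rewrite trmx_drsub symT.
pose K : 'M[R]_(1 + n) := block_mx 1%:M 0 0 Q'.
have KK : K *m K^T = 1%:M.
  rewrite tr_block_mx !trmx0 trmx1 mulmx_block !mulmx0 !mul0mx !addr0 add0r.
  by rewrite mulmx1 QQ -scalar_mx_block.
have KT : T = K^T *m diag_mx (row_mx a%:M D') *m K.
  rewrite TE {1}DE diag_mx_row tr_block_mx !trmx0 trmx1 !mulmx_block.
  rewrite !mulmx0 !mul0mx !addr0 !add0r !mul1mx !mulmx1 !mul0mx.
  by congr block_mx; apply/matrixP => i j; rewrite !ord1 !mxE.
exists (K *m H), (row_mx a%:M D'); split.
  by rewrite trmx_mul mulmxA -[K *m H *m _]mulmxA HH mulmx1.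
have -> : S = H^T *m T *m H.
  by rewrite /T !mulmxA HTH mul1mx -mulmxA HTH mulmx1.
by rewrite trmx_mul KT !mulmxA.
Qed.

(** * Eigenbasis of a reversible chain and its spectral gap *)

(** The inner product of L^2 of the measure [m]. *)
Definition inner (R : realType) (V : finType) (m f g : V -> R) : R :=
  \sum_x m x * f x * g x.

Definition chain_op (R : realType) (V : finType) (P : V -> V -> R)
    (f : V -> R) (x : V) : R :=
  \sum_y P x y * f y.

(** Detailed balance says that [sqrt (m x) * P x y / sqrt (m y)] is symmetric.
    An orthonormal eigenbasis of that matrix, divided by [sqrt m], is an
    [m]-orthonormal eigenbasis of [P]. The conclusions are Parseval's identity
    and the diagonal action of [P], which is the form used for computing with
    the quadratic forms of [P]. *)
Lemma reversible_eigenbasis (R : realType) (V : finType) (P : V -> V -> R)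
    (m : V -> R) :
  (forall x, 0 < m x) -> (forall x y, m x * P x y = m y * P y x) ->
  exists (lam : 'I_#|V| -> R) (phi : 'I_#|V| -> V -> R),
    [/\ forall i j, inner m (phi i) (phi j) = (i == j)%:R,
        forall f g, inner m f g = \sum_i inner m f (phi i) * inner m g (phi i),
        forall f i, inner m (chain_op P f) (phi i) = lam i * inner m f (phi i) &
        char_poly (transition_matrix P) = \prod_i ('X - (lam i)%:P)].
Proof.
move=> m_gt0 revP.
pose s x := Num.sqrt (m x).
have s_neq0 x : s x != 0 by rewrite gt_eqF // sqrtr_gt0.
have ssE x : s x * s x = m x by rewrite -expr2 sqr_sqrtr // ltW.
pose ev : 'I_#|V| -> V := enum_val.
pose S : 'M[R]_#|V| := \matrix_(i, j) (s (ev i) * P (ev i) (ev j) / s (ev j)).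
have symS : S^T = S.
  apply/matrixP => i j; rewrite !mxE.
  apply: (mulfI (s_neq0 (ev i))); apply: (mulIf (s_neq0 (ev j))).
  rewrite mulrA [RHS]mulrC !mulrA [in RHS]mulrC.
  have := revP (ev j) (ev i); rewrite -!ssE => h.
  rewrite mulrAC [X in X / _]mulrC.
  have -> : s (ev j) * (s (ev i) * s (ev j) * P (ev j) (ev i)) / s (ev i) =
            s (ev j) * s (ev j) * P (ev j) (ev i) by field.
  by rewrite h; field.
have [Q [D [QQ SE]]] := real_spectral_theorem symS.
have QTQ := mulmx1C QQ.
pose F (f : V -> R) : 'rV[R]_#|V| := \row_i (s (ev i) * f (ev i)).
pose phi i x := Q i (enum_rank x) / s x.
have reindexV (G : V -> R) : \sum_x G x = \sum_i G (ev i).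
  by rewrite (reindex ev) //; exact: onW_bij (enum_val_bij V).
have FE f g : inner m f g = (F f *m (F g)^T) 0 0.
  rewrite /inner reindexV !mxE; apply: eq_bigr => i _.
  by rewrite !mxE -ssE; ring.
have Fphi i : F (phi i) = row i Q.
  by apply/rowP => j; rewrite !mxE /phi /ev enum_valK mulrC divfK.
have coefE f i : inner m f (phi i) = (F f *m Q^T) 0 i.
  by rewrite FE Fphi !mxE; apply: eq_bigr => j _; rewrite !mxE.
have FP f : F (chain_op P f) = F f *m S.
  apply/rowP => j; rewrite !mxE /chain_op reindexV mulr_sumr.
  apply: eq_bigr => i _; rewrite !mxE.
  have := revP (ev i) (ev j); rewrite -!ssE => h.
  have -> : s (ev i) * f (ev i) * (s (ev i) * P (ev i) (ev j) / s (ev j)) =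
            (s (ev i) * s (ev i) * P (ev i) (ev j)) * f (ev i) / s (ev j).
    by field.
  by rewrite h; field.
exists (D 0), phi; split.
- by move=> i j; rewrite coefE Fphi -row_mul QQ row1 !mxE eq_sym.
- move=> f g; rewrite FE -[F f]mulmx1 -QTQ mulmxA -mulmxA.
  rewrite -{2}[Q]trmxK -trmx_mul.
  by rewrite mxE; apply: eq_bigr => i _; rewrite !coefE [_^T _ _]mxE.
- move=> f i; rewrite !coefE FP SE -!mulmxA QQ mulmx1 mulmxA mul_mx_diag !mxE.
  by rewrite mulrC.
have -> : transition_matrix P =
    diag_mx (\row_i (s (ev i))^-1) *m S *m diag_mx (\row_i s (ev i)).
  apply/matrixP => i j; rewrite mul_mx_diag mxE mul_diag_mx !mxE.
  by rewrite -/(ev i) -/(ev j); field; rewrite !s_neq0.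
rewrite char_poly_conj; last first.
  apply/matrixP => i j; rewrite mul_diag_mx !mxE.
  by case: eqP => [->|_]; rewrite ?mulr0 // mulr1n mulfV.
rewrite SE char_poly_conj // char_poly_trig ?diag_mx_is_trig //.
by apply: eq_bigr => i _; rewrite !mxE eqxx mulr1n.
Qed.

(** Sorting the indices rather than the eigenvalues keeps track of the two
    eigenvectors that belong to the two largest eigenvalues, also when these
    coincide. *)
Lemma spectral_gap_eigenvalue (R : realType) (V : finType) (P : V -> V -> R)
    (lam : 'I_#|V| -> R) :
  (1 < #|V|)%N ->
  char_poly (transition_matrix P) = \prod_i ('X - (lam i)%:P) ->
  exists i0 i1, [/\ i0 != i1, spectral_gap P = 1 - lam i1, lam i1 <= lam i0 &
    forall k, k != i0 -> lam k <= lam i1].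
Proof.
move=> V_gt1 charP.
pose r : rel 'I_#|V| := fun i j => lam j <= lam i.
have r_tr : transitive r by move=> j i k ij jk; exact: le_trans jk ij.
pose t := sort r (enum 'I_#|V|).
have t_perm : perm_eq t (enum 'I_#|V|) by rewrite perm_sort.
have t_sorted : sorted r t by apply: sort_sorted => i j; exact: le_total.
have specP : is_spectrum (transition_matrix P) (map lam t).
  split; first by rewrite sorted_map.
  by rewrite charP big_map (perm_big _ t_perm) /= big_enum.
have t_size : size t = #|V| by rewrite size_sort -cardE card_ord.
rewrite /spectral_gap (spectrumE specP).
have t_uniq : uniq t by rewrite sort_uniq enum_uniq.
have t_mem k : k \in t by rewrite mem_sort mem_enum.
case: t t_sorted t_size t_uniq t_mem {t_perm specP} => [|i0 [|i1 t]] /=.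
- by move=> _ h; rewrite -h in V_gt1.
- by move=> _ h; rewrite -h in V_gt1.
move=> /andP[r01 pt] _ /andP[]; rewrite inE negb_or => /andP[i01 _] _ t_mem.
exists i0, i1; split=> // k ki0; have := t_mem k.
rewrite !inE (negPf ki0) /= => /orP[/eqP -> //|kt].
by have /allP := order_path_min r_tr pt; apply.
Qed.

Lemma spectral_gap_small (R : realType) (V : finType) (P : V -> V -> R) :
  (#|V| <= 1)%N -> spectral_gap P = 1.
Proof.
move=> V1; rewrite /spectral_gap /spectrum.
case: xgetP => [s _ [_ /(congr1 (fun p : {poly R} => size p))]|_]; last first.
  by rewrite nth_nil subr0.
rewrite size_char_poly size_prod_XsubC => -[sE].
by rewrite nth_default ?subr0 // -sE.
Qed.

(** * Dirichlet form of a weighted graph *)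

Definition dirichlet_form (R : realType) (V : finType) (e : rel V)
    (w : V -> V -> R) (f : V -> R) : R :=
  2^-1 * \sum_x \sum_(y | e x y) w x y * (f x - f y) ^+ 2.

Section WeightedChain.
Context (R : realType) (V : finType) (e : rel V) (w : V -> V -> R).
Hypothesis e_sym : symmetric e.
Hypothesis e_nbr : forall x, exists y, e x y.
Hypothesis w_edge : edge_weighting e w.

Local Notation m := (vertex_weight e w).
Local Notation P := (weighted_chain e w).

Lemma vertex_weight_gt0 x : 0 < m x.
Proof.
have [y exy] := e_nbr x; rewrite /vertex_weight (bigD1 y) //=.
rewrite ltr_wpDr ?(w_edge exy).1 // sumr_ge0 // => z /andP[exz _].
exact: ltW (w_edge exz).1.
Qed.

Lemma vertex_weight_chain x y : m x * P x y = if e x y then w x y else 0.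
Proof.
rewrite /weighted_chain; case: ifP => exy; last by rewrite mulr0.
by rewrite mulrC divfK // gt_eqF // vertex_weight_gt0.
Qed.

Lemma weighted_chain_reversible x y : m x * P x y = m y * P y x.
Proof.
rewrite !vertex_weight_chain e_sym; case: ifP => // exy.
by rewrite (w_edge exy).2.
Qed.

Lemma edge_sum_swap (F : V -> V -> R) :
  \sum_x \sum_(y | e x y) w x y * F x y = \sum_x \sum_(y | e x y) w x y * F y x.
Proof.
rewrite (exchange_big_dep xpredT) //=; apply: eq_bigr => y _.
rewrite (eq_bigl (e y)); last by move=> x; exact: e_sym.
by apply: eq_bigr => x eyx; rewrite (w_edge eyx).2.
Qed.

Lemma inner_edge_sum f g :
  inner m f g = \sum_x \sum_(y | e x y) w x y * (f x * g x).
Proof.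
by apply: eq_bigr => x _; rewrite -mulrA /vertex_weight mulr_suml.
Qed.

Lemma inner_chain_edge_sum f g :
  inner m (chain_op P f) g = \sum_x \sum_(y | e x y) w x y * (f y * g x).
Proof.
apply: eq_bigr => x _; rewrite /chain_op mulr_sumr mulr_suml [RHS]big_mkcond.
apply: eq_bigr => y _; rewrite mulrA vertex_weight_chain.
by case: ifP => _; rewrite ?mul0r // mulrA.
Qed.

(** Expanding the square, both diagonal terms give the norm by symmetry of the
    edge sums, and the cross term gives the action of the chain. *)
Lemma dirichlet_formE f :
  dirichlet_form e w f = inner m f f - inner m (chain_op P f) f.
Proof.
apply: (mulfI (_ : (2 : R) != 0)); first by rewrite pnatr_eq0.
rewrite /dirichlet_form mulVKf ?pnatr_eq0 // mulrBr inner_chain_edge_sum.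
rewrite mulr_natl mulr2n [X in _ + X - _]inner_edge_sum.
rewrite [X in _ + X - _]edge_sum_swap inner_edge_sum -big_split.
rewrite mulr_sumr -sumrB /=.
apply: eq_bigr => x _; rewrite -big_split mulr_sumr -sumrB /=.
by apply: eq_bigr => y _; ring.
Qed.

Lemma dirichlet_form_ge0 f : 0 <= dirichlet_form e w f.
Proof.
rewrite mulr_ge0 // ?invr_ge0 // sumr_ge0 // => x _; apply: sumr_ge0 => y exy.
by rewrite mulr_ge0 ?sqr_ge0 // ltW // (w_edge exy).1.
Qed.

(** The difference of the two sides is the edge sum of [(f x + f y) ^+ 2]; this
    is the statement that eigenvalues are at least -1. *)
Lemma dirichlet_form_le f : dirichlet_form e w f <= 2 * inner m f f.
Proof.
rewrite -(ler_pM2l (_ : (0 : R) < 2)) // /dirichlet_form mulVKf ?pnatr_eq0 //.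
have -> : 2 * (2 * inner m f f) =
    \sum_x \sum_(y | e x y) w x y * (2 * (f x ^+ 2 + f y ^+ 2)).
  transitivity (2 * (inner m f f + inner m f f)); first by ring.
  rewrite {2}inner_edge_sum edge_sum_swap inner_edge_sum -big_split.
  rewrite mulr_sumr /=.
  apply: eq_bigr => x _; rewrite -big_split mulr_sumr /=.
  by apply: eq_bigr => y _; ring.
apply: ler_sum => x _; apply: ler_sum => y exy.
rewrite ler_wpM2l // ?(ltW (w_edge exy).1) //.
by have := sqr_ge0 (f x + f y); nra.
Qed.

Lemma chain_eigenbasis :
  exists (lam : 'I_#|V| -> R) (phi : 'I_#|V| -> V -> R),
    [/\ forall i j, inner m (phi i) (phi j) = (i == j)%:R,
        forall f g, inner m f g = \sum_i inner m f (phi i) * inner m g (phi i),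
        forall f i, inner m (chain_op P f) (phi i) = lam i * inner m f (phi i) &
        char_poly (transition_matrix P) = \prod_i ('X - (lam i)%:P)].
Proof.
exact: reversible_eigenbasis vertex_weight_gt0 weighted_chain_reversible.
Qed.

Lemma dirichlet_form_eq0_constant f :
  connected_graph e -> dirichlet_form e w f = 0 -> forall x y, f x = f y.
Proof.
move=> e_conn /eqP; rewrite mulf_eq0 invr_eq0 pnatr_eq0 /=.
have ge0 x y : e x y -> 0 <= w x y * (f x - f y) ^+ 2.
  by move=> exy; rewrite mulr_ge0 ?sqr_ge0 // ltW // (w_edge exy).1.
rewrite psumr_eq0; last by move=> x _; apply: sumr_ge0 => y /ge0.
move=> /allP D0 x y.
have edge_eq a b : e a b -> f a == f b.
  move=> eab; have := D0 a (mem_index_enum a); rewrite /= psumr_eq0; last first.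
    by move=> c /ge0.
  move=> /allP /(_ b (mem_index_enum b)) /implyP /(_ eab).
  by rewrite mulf_eq0 sqrf_eq0 subr_eq0 gt_eqF ?(w_edge eab).1.
have /connectP[p pth ->] := e_conn x y.
elim: p x pth => //= z p IHp x /andP[/edge_eq /eqP -> pth]; exact: IHp.
Qed.

End WeightedChain.

(** * Variational characterisation of the gap *)

Section Gap.
Context (R : realType) (V : finType) (e : rel V) (w : V -> V -> R).
Hypothesis e_sym : symmetric e.
Hypothesis e_nbr : forall x, exists y, e x y.
Hypothesis w_edge : edge_weighting e w.
Hypothesis V_gt1 : (1 < #|V|)%N.

Local Notation m := (vertex_weight e w).
Local Notation P := (weighted_chain e w).

Lemma gap_eigenbasis :
  exists (lam : 'I_#|V| -> R) (phi : 'I_#|V| -> V -> R) i0 i1,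
    [/\ forall i j, inner m (phi i) (phi j) = (i == j)%:R,
        forall f g, inner m f g = \sum_i inner m f (phi i) * inner m g (phi i),
        forall f i, inner m (chain_op P f) (phi i) = lam i * inner m f (phi i),
        forall f, dirichlet_form e w f =
          \sum_i (1 - lam i) * inner m f (phi i) ^+ 2 &
        [/\ i0 != i1, spectral_gap P = 1 - lam i1, lam i1 <= lam i0 &
            forall k, k != i0 -> lam k <= lam i1]].
Proof.
have [lam [phi [orth pars eig charP]]] := chain_eigenbasis e_sym e_nbr w_edge.
have [i0 [i1 gapP]] := spectral_gap_eigenvalue V_gt1 charP.
exists lam, phi, i0, i1; split=> // f.
rewrite (dirichlet_formE e_sym e_nbr w_edge) !pars -sumrB.
by apply: eq_bigr => i _; rewrite eig; ring.
Qed.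

Lemma dirichlet_form_basis (lam : 'I_#|V| -> R) (phi : 'I_#|V| -> V -> R) i :
  (forall i j, inner m (phi i) (phi j) = (i == j)%:R) ->
  (forall f, dirichlet_form e w f =
    \sum_i (1 - lam i) * inner m f (phi i) ^+ 2) ->
  dirichlet_form e w (phi i) = 1 - lam i.
Proof.
move=> orth ->; rewrite (bigD1 i) //= orth eqxx expr1n mulr1 big1 ?addr0 //.
by move=> j ji; rewrite orth eq_sym (negPf ji) expr0n mulr0.
Qed.

Lemma chain_op1 : chain_op P (fun=> 1) =1 fun=> 1.
Proof.
move=> x; rewrite /chain_op /weighted_chain.
under eq_bigr do rewrite mulr1.
by rewrite -big_mkcond -mulr_suml mulfV // gt_eqF // vertex_weight_gt0.
Qed.

(** If the second eigenvalue is below 1, the constants span the eigenspace of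
    the top eigenvalue, so [g] only has coefficients on eigenvalues at most the
    second one. If it equals 1, the gap vanishes and positivity of the Dirichlet
    form suffices. *)
Lemma spectral_gap_poincare g :
  inner m g (fun=> 1) = 0 ->
  spectral_gap P * inner m g g <= dirichlet_form e w g.
Proof.
move=> g1; have [lam [phi [i0 [i1 [orth pars eig dirE]]]]] := gap_eigenbasis.
move=> [i01 -> _ lam_le].
have lam_le1 i : lam i <= 1.
  by rewrite -subr_ge0 -(dirichlet_form_basis i orth dirE) dirichlet_form_ge0.
have [lam1|lam1] := eqVneq (lam i1) 1.
  by rewrite lam1 subrr mul0r dirichlet_form_ge0.
have one_coef i : i != i0 -> inner m (fun=> 1) (phi i) = 0.
  move=> ii0; have := eig (fun=> 1) i.
  have -> : inner m (chain_op P (fun=> 1)) (phi i) = inner m (fun=> 1) (phi i).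
    by apply: eq_bigr => x _; rewrite chain_op1.
  move=> /eqP; rewrite -subr_eq0 -{1}[inner _ _ _]mul1r -mulrBl mulf_eq0.
  case/orP => [|/eqP //]; rewrite subr_eq0 => /eqP lami.
  have := lam_le _ ii0; rewrite -lami le_eqVlt ltNge lam_le1 orbF.
  by rewrite eq_sym (negPf lam1).
have one_norm : 0 < inner m (fun=> 1) (fun=> 1).
  have /card_gt0P[x _] := ltnW V_gt1.
  rewrite /inner (bigD1 x) //= !mulr1 ltr_wpDr ?vertex_weight_gt0 //.
  by apply: sumr_ge0 => y _; rewrite !mulr1 ltW // vertex_weight_gt0.
have g0 : inner m g (phi i0) = 0.
  have one0 : inner m (fun=> 1) (phi i0) != 0.
    apply: contraTneq one_norm => c0.
    rewrite pars (bigD1 i0) //= c0 mul0r add0r.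
    by rewrite big1 ?ltxx // => i /one_coef ->; rewrite mul0r.
  apply: (mulIf one0); rewrite mul0r -[RHS]g1 [RHS]pars (bigD1 i0) //=.
  by rewrite [X in _ + X]big1 ?addr0 // => i /one_coef ->; rewrite mulr0.
rewrite dirE pars mulr_sumr; apply: ler_sum => i _; rewrite -expr2.
have [->|ii0] := eqVneq i i0; first by rewrite g0 expr0n !mulr0.
by rewrite ler_wpM2r ?sqr_ge0 // lerB // lam_le.
Qed.

Lemma inner_linearl (a b : R) f g h :
  inner m (fun x => a * f x + b * g x) h = a * inner m f h + b * inner m g h.
Proof.
by rewrite /inner !mulr_sumr -big_split; apply: eq_bigr => x _ /=; ring.
Qed.

(** The easy half of the Courant-Fischer principle: one linear condition
    [\sum_x u x * f x = 0] is always met by some nonzero combination of the top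
    two eigenvectors, whose Rayleigh quotient is at most the gap. The freedom in
    [u] is what makes the comparison below work: [u] need not be the weight of
    the chain. *)
Lemma spectral_gap_ge (u : V -> R) (delta : R) :
  (forall f, \sum_x u x * f x = 0 ->
    delta * inner m f f <= dirichlet_form e w f) ->
  delta <= spectral_gap P.
Proof.
move=> Hu; have [lam [phi [i0 [i1 [orth pars eig dirE]]]]] := gap_eigenbasis.
move=> [i01 -> lam_le _].
pose U f := \sum_x u x * f x.
have [U1|U1] := eqVneq (U (phi i1)) 0.
  have := Hu _ U1; rewrite orth eqxx mulr1.
  by rewrite (dirichlet_form_basis i1 orth dirE).
(* The combination of the top two eigenvectors annihilated by [U]. *)
pose a := U (phi i1); pose b := - U (phi i0).
pose f x := a * phi i0 x + b * phi i1 x.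
have Uf : U f = 0.
  transitivity (a * U (phi i0) + b * U (phi i1)); last by rewrite /a /b; ring.
  rewrite /U !mulr_sumr -big_split; apply: eq_bigr => x _ /=.
  by rewrite /f; ring.
have coef i : inner m f (phi i) = a * (i0 == i)%:R + b * (i1 == i)%:R.
  by rewrite inner_linearl !orth.
have sumE (c : 'I_#|V| -> R) :
    \sum_i c i * inner m f (phi i) ^+ 2 = c i0 * a ^+ 2 + c i1 * b ^+ 2.
  rewrite (bigD1 i0) //= (bigD1 i1) 1?eq_sym //= big1 => [|i /andP[ni0 ni1]].
    rewrite !coef !eqxx (negPf i01) eq_sym (negPf i01).
    by rewrite !(mulr0, mulr1, addr0, add0r).
  rewrite coef ![_ == i]eq_sym (negPf ni0) (negPf ni1).
  by rewrite !mulr0 addr0 expr0n mulr0.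
have ff : inner m f f = a ^+ 2 + b ^+ 2.
  rewrite pars; have := sumE (fun=> 1); rewrite !mul1r => <-.
  by apply: eq_bigr => i _; rewrite mul1r expr2.
have ab_gt0 : 0 < a ^+ 2 + b ^+ 2.
  by rewrite ltr_wpDr ?sqr_ge0 // exprn_even_gt0.
rewrite -(ler_pM2r ab_gt0) -ff; apply: le_trans (Hu _ Uf) _.
rewrite dirE sumE ff mulrDr lerD2r ler_wpM2r ?sqr_ge0 //.
by rewrite lerB.
Qed.

Lemma spectral_gap_le2 : spectral_gap P <= 2.
Proof.
have [lam [phi [i0 [i1 [orth pars eig dirE]]]]] := gap_eigenbasis.
move=> [_ -> _ _]; rewrite -(dirichlet_form_basis i1 orth dirE).
have := dirichlet_form_le e_sym w_edge (phi i1).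
by rewrite orth eqxx mulr1.
Qed.

(** A zero gap would give two orthonormal functions of zero energy, hence two
    constants on a connected graph. *)
Lemma spectral_gap_gt0 : connected_graph e -> 0 < spectral_gap P.
Proof.
move=> e_conn.
have [lam [phi [i0 [i1 [orth pars eig dirE]]]]] := gap_eigenbasis.
move=> [i01 -> lam_le _].
have dirB i := dirichlet_form_basis i orth dirE.
have lam_le1 i : lam i <= 1 by rewrite -subr_ge0 -dirB dirichlet_form_ge0.
rewrite subr_gt0 lt_neqAle lam_le1 andbT; apply/eqP => lam1.
have lam0 : lam i0 = 1 by apply/le_anti; rewrite lam_le1 -lam1 lam_le.
have constP i : lam i = 1 -> forall x y, phi i x = phi i y.
  move=> lami; have D0 : dirichlet_form e w (phi i) = 0.
    by rewrite dirB lami subrr.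
  by move=> x y; exact: (dirichlet_form_eq0_constant w_edge e_conn D0).
have c0 := constP _ lam0; have c1 := constP _ lam1.
have /card_gt0P[x _] := ltnW V_gt1.
have ipE i j :
    (forall x y, phi i x = phi i y) -> (forall x y, phi j x = phi j y) ->
    inner m (phi i) (phi j) = phi i x * phi j x * \sum_y m y.
  move=> ci cj; rewrite mulr_sumr; apply: eq_bigr => y _.
  by rewrite (ci y x) (cj y x); ring.
have n0 := orth i0 i0; have n1 := orth i1 i1; have := orth i0 i1.
rewrite !ipE // (negPf i01) => /eqP.
rewrite ipE // eqxx in n0; rewrite ipE // eqxx in n1.
rewrite !mulf_eq0 -orbA => /or3P[] /eqP h; move: n0 n1; rewrite h;
 rewrite ?mul0r ?mulr0; move=> /eqP; rewrite ?(eq_sym 0) ?oner_eq0 //.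
by move=> _ /esym/eqP; rewrite oner_eq0.
Qed.

End Gap.

(** * Comparison with the simple random walk *)

(** The simple random walk is the chain of the constant weighting, so what
    holds for weighted chains applies to both walks. *)
Lemma simple_random_walkE (R : realType) (V : finType) (e : rel V) :
  spectral_gap (simple_random_walk R e) =
  spectral_gap (weighted_chain e (fun _ _ => 1)).
Proof.
congr (1 - nth 0 (spectrum _) 1); apply/matrixP => i j; rewrite !mxE.
rewrite /simple_random_walk /weighted_chain /vertex_weight /degree.
by rewrite sumr_const mul1r.
Qed.

Lemma connected_neighbour (V : finType) (e : rel V) :
  connected_graph e -> (1 < #|V|)%N -> forall x, exists y, e x y.
Proof.
move=> e_conn V_gt1 x.
have /subsetPn[y _] : ~~ ([set: V] \subset [set x]).
  by apply: contraTN V_gt1 => /subset_leq_card; rewrite cardsT cards1 leqNgt.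
rewrite inE => yx; have /connectP[[|z p] /= pth yE] := e_conn x y.
  by rewrite yE eqxx in yx.
by exists z; case/andP: pth.
Qed.

Section Comparison.
Context (R : realType) (V : finType) (e : rel V) (d : nat).
Hypothesis e_sym : symmetric e.
Hypothesis e_nbr : forall x, exists y, e x y.
Hypothesis e_reg : regular_graph e d.
Hypothesis V_gt1 : (1 < #|V|)%N.

Let w1 : V -> V -> R := fun _ _ => 1.

Lemma edge_weighting1 : edge_weighting e w1.
Proof. by move=> x y _; rewrite ltr01. Qed.

Lemma vertex_weight1 x : vertex_weight e w1 x = d%:R.
Proof. by rewrite /vertex_weight sumr_const -(e_reg x). Qed.

Section Lipschitz.
Context (w : V -> V -> R) (beta : R).
Hypothesis w_edge : edge_weighting e w.
Hypothesis beta_ge1 : 1 <= beta.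
Hypothesis w_lip : lipschitz_weighting e beta w.

Local Notation m := (vertex_weight e w).
Local Notation s := (fun x => Num.sqrt (m x)).

Lemma lipschitz_le x y z : e x y -> e x z -> w x y <= beta * w x z.
Proof.
move=> exy exz; have eyx : e y x by rewrite e_sym.
have [_] := w_lip eyx exz.
by rewrite ler_pdivrMr // (w_edge exz).1.
Qed.

Lemma vertex_weight_le x y : e x y -> m x <= d%:R * (beta * w x y).
Proof.
move=> exy; rewrite -(vertex_weight1 x) mulr_suml.
by apply: ler_sum => z exz; rewrite mul1r lipschitz_le.
Qed.

Lemma vertex_weight_ge x y : e x y -> d%:R * w x y <= beta * m x.
Proof.
move=> exy; rewrite -(vertex_weight1 x) mulr_suml mulr_sumr.
by apply: ler_sum => z exz; rewrite mul1r lipschitz_le.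
Qed.

(** With [y] a neighbour of [x], both [m x] and [m y] are within a factor
    [beta] of [d * w x y], so they are within a factor [beta ^+ 2] of each
    other. *)
Lemma sqrt_vertex_weight_le x y : e x y -> s x <= beta * s y.
Proof.
move=> exy; have beta_ge0 : 0 <= beta by apply: le_trans beta_ge1.
suff : s x <= Num.sqrt (beta ^+ 2 * m y).
  by rewrite sqrtrM ?sqr_ge0 // sqrtr_sqr ger0_norm.
rewrite ler_wsqrtr //.
apply: le_trans (vertex_weight_le exy) _.
rewrite mulrCA expr2 -mulrA ler_wpM2l // (w_edge exy).2.
by apply: vertex_weight_ge; rewrite e_sym.
Qed.

Lemma sqrt_vertex_weight_lip x y :
  e x y -> (s x - s y) ^+ 2 <= (beta - 1) ^+ 2 * m y.
Proof.
move=> exy; have sxy := sqrt_vertex_weight_le exy.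
have syx : s y <= beta * s x by apply: sqrt_vertex_weight_le; rewrite e_sym.
have my : m y = s y ^+ 2 by rewrite sqr_sqrtr // ltW // vertex_weight_gt0.
rewrite [X in _ * X]my -exprMn /=.
move: beta_ge1 sxy syx (sqrtr_ge0 (m x)) (sqrtr_ge0 (m y)).
move: (Num.sqrt (m x)) (Num.sqrt (m y)) => {my} a b b1 ab ba a0 b0.
rewrite -subr_ge0 subr_sqr mulr_ge0 //; nra.
Qed.

(** The Poincare inequality of the simple random walk applied to
    [g = sqrt m * f], which has mean zero by hypothesis and whose norm in the
    counting measure is the [m]-norm of [f]. Along an edge,
    [g x - g y = sqrt (m x) * (f x - f y) + f y * (sqrt (m x) - sqrt (m y))]:
    the first term is controlled by the energy of [f] since
    [m x <= d * beta * w x y], and the second one is at most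
    [(beta - 1) * sqrt (m y) * f y]. *)
Lemma ground_state_comparison f :
  \sum_x s x * f x = 0 ->
  (spectral_gap (weighted_chain e w1) - (beta - 1) ^+ 2) * inner m f f <=
  2 * beta * dirichlet_form e w f.
Proof.
move=> sf; pose g x := s x * f x.
have m_gt0 := vertex_weight_gt0 e_nbr w_edge.
have sqr_s x : s x ^+ 2 = m x by rewrite sqr_sqrtr // ltW.
have gE x : g x ^+ 2 = m x * f x * f x.
  by rewrite exprMn sqr_s expr2 mulrA.
have d_gt0 : 0 < d%:R :> R.
  have /card_gt0P[x _] := ltnW V_gt1.
  rewrite -(vertex_weight1 x).
  exact: vertex_weight_gt0 e_nbr edge_weighting1 x.
have ip1 h k : inner (vertex_weight e w1) h k = d%:R * \sum_x h x * k x.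
  by rewrite mulr_sumr; apply: eq_bigr => x _; rewrite vertex_weight1 mulrA.
have := @spectral_gap_poincare _ _ e w1 e_sym e_nbr edge_weighting1 V_gt1 g.
rewrite !ip1; under eq_bigr do rewrite mulr1.
rewrite sf mulr0 => /(_ erefl).
have -> : \sum_x g x * g x = inner m f f.
  by apply: eq_bigr => x _; rewrite -expr2 gE.
have D1 : dirichlet_form e w1 g <=
    d%:R * (2 * beta * dirichlet_form e w f + (beta - 1) ^+ 2 * inner m f f).
  have edge_le x y : e x y -> w1 x y * (g x - g y) ^+ 2 <=
      2 * (d%:R * beta) * (w x y * (f x - f y) ^+ 2) +
      2 * (beta - 1) ^+ 2 * (w1 x y * (m y * f y * f y)).
    move=> exy; rewrite /w1 !mul1r.
    have -> : g x - g y = s x * (f x - f y) + f y * (s x - s y).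
      by rewrite /g /=; ring.
    apply: (@le_trans _ _ (2 * (s x * (f x - f y)) ^+ 2 +
                           2 * (f y * (s x - s y)) ^+ 2)).
      by have := sqr_ge0 (s x * (f x - f y) - f y * (s x - s y)); nra.
    rewrite !exprMn sqr_s; apply: lerD.
      have -> : 2 * (d%:R * beta) * (w x y * (f x - f y) ^+ 2) =
                2 * (d%:R * (beta * w x y) * (f x - f y) ^+ 2) by ring.
      by rewrite ler_wpM2l // ler_wpM2r ?sqr_ge0 // vertex_weight_le.
    have -> : 2 * (beta - 1) ^+ 2 * (m y * f y * f y) =
              2 * (f y ^+ 2 * ((beta - 1) ^+ 2 * m y)) by ring.
    by rewrite ler_wpM2l // ler_wpM2l ?sqr_ge0 // sqrt_vertex_weight_lip.
  rewrite -(ler_pM2l (_ : (0 : R) < 2)) // /dirichlet_form mulVKf ?pnatr_eq0 //.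
  apply: (@le_trans _ _ (2 * (d%:R * beta) *
      \sum_x \sum_(y | e x y) w x y * (f x - f y) ^+ 2 +
      2 * (beta - 1) ^+ 2 *
      \sum_x \sum_(y | e x y) w1 x y * (m y * f y * f y))).
    rewrite !mulr_sumr -big_split; apply: ler_sum => x _ /=.
    rewrite !mulr_sumr -big_split; apply: ler_sum => y exy /=.
    exact: edge_le.
  rewrite (edge_sum_swap e_sym edge_weighting1 (fun x y => m y * f y * f y)).
  have -> : \sum_x \sum_(y | e x y) w1 x y * (m x * f x * f x) =
            d%:R * inner m f f.
    rewrite /inner mulr_sumr; apply: eq_bigr => x _.
    by rewrite -mulr_suml -/(vertex_weight e w1 x) vertex_weight1.
  by rewrite le_eqVlt; apply/orP; left; apply/eqP; field.
move=> /le_trans /(_ D1); rewrite mulrCA ler_pM2l // => h.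
by rewrite mulrBl lerBlDr.
Qed.

(** A bound linear in the gap of the simple random walk; the orthogonality
    condition is taken against [sqrt m], as the comparison requires. *)
Theorem lipschitz_spectral_gap :
  (spectral_gap (weighted_chain e w1) - (beta - 1) ^+ 2) / (2 * beta) <=
  spectral_gap (weighted_chain e w).
Proof.
have beta2 : 0 < 2 * beta by rewrite mulr_gt0 // (lt_le_trans ltr01).
apply: (@spectral_gap_ge _ _ e w e_sym e_nbr w_edge V_gt1 s) => f sf.
rewrite mulrAC ler_pdivrMr // [X in _ <= X]mulrC.
exact: ground_state_comparison.
Qed.

End Lipschitz.

(** A connected 1-regular graph is a single edge. Testing functions that vanish
    at one endpoint gives the bound 1. *)
Lemma one_regular_gap :
  connected_graph e -> irreflexive e -> d = 1%N ->
  1 <= spectral_gap (weighted_chain e w1).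
Proof.
move=> e_conn e_irr d1; have /card_gt0P[x _] := ltnW V_gt1.
have [y exy] := e_nbr x.
have nb a b c : e a b -> e a c -> b = c.
  move=> eab eac.
  have /card_le1_eqP h : (#|[pred z | e a z]| <= 1)%N.
    by rewrite -/(degree e a) e_reg d1.
  by apply: h; rewrite inE.
have eyx : e y x by rewrite e_sym.
have V2 z : (z == x) || (z == y).
  have /connectP[p pth ->] := e_conn x z.
  suff walk a : path e a p -> (a == x) || (a == y) ->
      (last a p == x) || (last a p == y) by apply: walk; rewrite ?eqxx.
  elim: p {pth} a => //= b p IHp a /andP[eab pth] ha; apply: IHp => //.
  case/orP: ha => /eqP aE; rewrite aE in eab.
    by rewrite (nb _ _ _ eab exy) eqxx orbT.
  by rewrite (nb _ _ _ eab eyx) eqxx.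
have xy : x != y by apply: contraTneq exy => <-; rewrite e_irr.
have sumV (F : V -> R) : \sum_z F z = F x + F y.
  rewrite (bigD1 x) //= (bigD1 y) 1?eq_sym //= big1 ?addr0 // => z /andP[zx zy].
  by have := V2 z; rewrite (negPf zx) (negPf zy).
have sumE (F : V -> R) a b : e a b -> \sum_(z | e a z) F z = F b.
  move=> eab; rewrite (big_pred1 b) // => z; apply/idP/eqP => [eaz|-> //].
  exact: nb eaz eab.
apply: (@spectral_gap_ge _ _ e w1 e_sym e_nbr edge_weighting1 V_gt1
          (fun z => (z == x)%:R)) => f.
rewrite sumV eqxx eq_sym (negPf xy) mul1r mul0r addr0 => fx.
rewrite /dirichlet_form /inner !sumV !vertex_weight1 d1.
rewrite (sumE _ _ _ exy) (sumE _ _ _ eyx).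
by rewrite /w1 fx le_eqVlt; apply/orP; left; apply/eqP; field.
Qed.

End Comparison.

(** From [d ^ r >= 2 ^ r >= 1 + r * ln 2] and [ln 2 >= 1/2], at
    [r = 16 / gamma]. *)
Lemma powR_natN_le (R : realType) (d : nat) (gamma : R) :
  (1 < d)%N -> 0 < gamma -> d%:R `^ (- (16 / gamma)) <= gamma / 8.
Proof.
move=> d_gt1 g_gt0; have d_gt0 : 0 < d%:R :> R by rewrite ltr0n ltnW.
have r_gt0 : 0 < 16 / gamma by rewrite divr_gt0.
rewrite powRN -[gamma / 8]invrK lef_pV2 ?posrE ?powR_gt0 ?invr_gt0 ?divr_gt0 //.
rewrite invf_div.
apply: (@le_trans _ _ (2 `^ (16 / gamma))); last first.
  by rewrite (ge0_ler_powR (ltW r_gt0)) ?nnegrE ?ler_nat.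
have ln2 : 1 / 2 <= ln 2 :> R.
  have := @le_ln1Dx R (- (1 / 2)) _.
  have -> : 1 + - (1 / 2) = 2^-1 :> R by field.
  rewrite lnV ?posrE // => /(_ _); lra.
rewrite /powR pnatr_eq0 /=; apply: le_trans (expR_ge1Dx _).
have -> : 8 / gamma = 16 / gamma * (1 / 2) by field; rewrite gt_eqF.
have : 16 / gamma * (1 / 2) <= 16 / gamma * ln 2 by rewrite ler_wpM2l // ltW.
lra.
Qed.

Lemma powR_natN_le1 (R : realType) (d : nat) (r : R) :
  0 <= r -> d%:R `^ (- r) <= 1.
Proof.
case: d => [|d] r_ge0; first by rewrite /powR eqxx lern1; case: eqP.
rewrite powRN invf_le1 ?powR_gt0 // -[X in X <= _](powRr0 d.+1%:R).
by rewrite ler_powR // ler1n.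
Qed.

Theorem theorem1p1 (R : realType) (V : finType) (e : rel V) (d : nat)
    (he_simple : simple_graph e) (he_conn : connected_graph e)
    (he_reg : regular_graph e d)
    (gamma : R) (hgamma : gamma = spectral_gap (simple_random_walk R e))
    (beta : R) (hbeta1 : 1 <= beta) (hbeta2 : beta <= 1 + gamma / 32)
    (w : V -> V -> R) (hw : edge_weighting e w)
    (hlip : lipschitz_weighting e beta w) :
  spectral_gap (weighted_chain e w) >= 10 ^- 8 * d%:R `^ (- (16 / gamma)).
Proof.
have [e_sym e_irr] := he_simple.
have c_le : 10 ^- 8 <= 1 / 8 :> R.
  by rewrite div1r lef_pV2 ?posrE // -natrX ler_nat.
have c_ge0 : 0 <= 10 ^- 8 :> R by rewrite invr_ge0 exprn_ge0.
have p_ge0 : 0 <= d%:R `^ (- (16 / gamma)) by exact: powR_ge0.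
have [V_le1|V_gt1] := leqP #|V| 1.
  rewrite hgamma !spectral_gap_small //.
  have := @powR_natN_le1 R d (16 / 1) ltac:(by rewrite divr_ge0).
  rewrite hgamma spectral_gap_small // in p_ge0.
  nra.
have e_nbr := connected_neighbour he_conn V_gt1.
rewrite simple_random_walkE in hgamma.
have w1_edge := @edge_weighting1 R V e.
have g_gt0 : 0 < gamma.
  by rewrite hgamma (spectral_gap_gt0 e_sym e_nbr w1_edge V_gt1).
have g_le2 : gamma <= 2.
  by rewrite hgamma (spectral_gap_le2 e_sym e_nbr w1_edge V_gt1).
have := lipschitz_spectral_gap e_sym e_nbr he_reg V_gt1 hw hbeta1 hlip.
rewrite -hgamma; apply: le_trans.
(* Since [gamma <= 2], the error [(beta - 1) ^+ 2] is at most [gamma / 512] and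
   [2 * beta <= 17 / 8], which leaves more than [gamma / 8]. *)
apply: (@le_trans _ _ (gamma / 8)); last first.
  rewrite ler_pdivlMr; last by lra.
  have : (beta - 1) ^+ 2 <= (gamma / 32) ^+ 2.
    by rewrite lerXn2r ?nnegrE; lra.
  nra.
(* For [d = 1] the right-hand side does not decay as [gamma] gets small, so an
   absolute lower bound on [gamma] is used instead. *)
have [d_le1|d_gt1] := leqP d 1; last first.
  by have := powR_natN_le d_gt1 g_gt0; nra.
have /card_gt0P[x _] := ltnW V_gt1; have [y exy] := e_nbr x.
have d1 : d = 1%N.
  apply/eqP; rewrite eqn_leq d_le1 -(he_reg x) /degree.
  by apply/card_gt0P; exists y.
have := @one_regular_gap R V e d e_sym e_nbr he_reg V_gt1 he_conn e_irr d1.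
rewrite -hgamma d1 powR1 mulr1 => g_ge1.
lra.
Qed.
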